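(* For every $\alpha \in (2,\infty)$, the inequality $\mathbb{E}|X-Y|^\alpha \le \mathbb{E}|X+Y|^\alpha$ does not hold in general for independent, identically distributed real-valued random variables with finite moment of order $\alpha$: there exist independent, identically distributed real-valued random variables $X, Y$ with $\mathbb{E}|X|^\alpha < \infty$ such that $$\mathbb{E}|X-Y|^\alpha > \mathbb{E}|X+Y|^\alpha.$$ *)

(* Defs.v *)
From HB Require Import structures.
From mathcomp Require Import all_boot all_order all_algebra.
From mathcomp Require Import all_classical all_reals all_analysis.

Set Implicit Arguments.
Unset Strict Implicit.
Unset Printing Implicit Defensive.

Local Open Scope classical_set_scope.
Local Open Scope ring_scope.
Local Open Scope ereal_scope.

Definition independent_RV d d1 d2 (T : measurableType d)
    (T1 : measurableType d1) (T2 : measurableType d2) (R : realType)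
    (P : probability T R) (X : {RV P >-> T1}) (Y : {RV P >-> T2}) : Prop :=
  forall (A : set T1) (B : set T2), measurable A -> measurable B ->
    P (X @^-1` A `&` Y @^-1` B) = P (X @^-1` A) * P (Y @^-1` B).

(* The laws are compared on measurable sets only: [distribution P X] is a
   function on all sets, with values unconstrained outside the sigma-algebra. *)
Definition identically_distributed d d' (T : measurableType d)
    (T' : measurableType d') (R : realType) (P : probability T R)
    (X Y : {RV P >-> T'}) : Prop :=
  forall A : set T', measurable A -> distribution P X A = distribution P Y A.

(* Main.v *)
Require Import Defs.
From HB Require Import structures.
From mathcomp Require Import all_boot all_order all_algebra.
From mathcomp Require Import all_classical all_reals all_analysis.
From mathcomp Require Import ring lra.

(** Take [X] equal to [1] with probability [p] and to [- y] with probability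
    [q = 1 - p], where [y] is small.  The inequality to prove is then
    [p^2 2^alpha + q^2 (2 y)^alpha < 2 p q ((1 + y)^alpha - (1 - y)^alpha)].
    The right-hand side is at least [4 p q y], and for [p / q] of order [y] it is
    of order [y^2], as is the first term on the left; the second term is of
    order [y^alpha], which is negligible exactly because [2 < alpha]. *)

Set Implicit Arguments.
Unset Strict Implicit.
Unset Printing Implicit Defensive.

Import Order.TTheory GRing.Theory Num.Theory.

Local Open Scope classical_set_scope.
Local Open Scope ring_scope.

(** Slicing by the first coordinate writes [A] as a union of two measurable rectangles. This gives
    the measurability that Tonelli requires of an arbitrary [g]. *)
Lemma measurable_bool_prod (A : set (bool * bool)) : measurable A.
Proof.
rewrite (_ : A = ([set true] `*` xsection A true) `|`
                 ([set false] `*` xsection A false)).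
  by apply: measurableU; apply: measurableX.
apply/seteqP; split=> [[[] b] Ab|[a b]] /=.
- by left; rewrite /xsection/= inE.
- by right; rewrite /xsection/= inE.
- by case=> -[->]; rewrite /xsection/= inE.
Qed.

Section iid_copies.
Context d (T : measurableType d) (R : realType) (P : probability T R).
Variables (f : T -> R) (mf : measurable_fun setT f).

Let PP : probability (T * T)%type R := (P \x P)%E.

(** The coordinates of the product space realize two i.i.d. copies of [f]. *)
Definition copy1 : {RV PP >-> R} :=
  mfun_Sub (mem_set (measurableT_comp mf measurable_fst) : f \o fst \in mfun).

Definition copy2 : {RV PP >-> R} :=
  mfun_Sub (mem_set (measurableT_comp mf measurable_snd) : f \o snd \in mfun).

Let preimage_measurable (A : set R) : measurable A -> measurable (f @^-1` A).
Proof. by move=> mA; rewrite -[X in measurable X]setTI; exact: mf. Qed.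

Lemma copy1_preimage (A : set R) : measurable A ->
  PP (copy1 @^-1` A) = P (f @^-1` A).
Proof.
move=> mA; rewrite (_ : copy1 @^-1` A = (f @^-1` A) `*` setT).
  rewrite /PP/= product_measure1E//; last exact: preimage_measurable.
  by rewrite -[RHS]mule1; congr (_ * _)%E; exact: probability_setT.
by apply/seteqP; split=> [[a b]|[a b] []].
Qed.

Lemma copy2_preimage (A : set R) : measurable A ->
  PP (copy2 @^-1` A) = P (f @^-1` A).
Proof.
move=> mA; rewrite (_ : copy2 @^-1` A = setT `*` (f @^-1` A)).
  rewrite /PP/= product_measure1E//; last exact: preimage_measurable.
  by rewrite -[RHS]mul1e; congr (_ * _)%E; exact: probability_setT.
by apply/seteqP; split=> [[a b]|[a b] []].
Qed.

Lemma copies_independent : independent_RV copy1 copy2.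
Proof.
move=> A B mA mB; rewrite copy1_preimage// copy2_preimage//.
rewrite (_ : _ `&` _ = (f @^-1` A) `*` (f @^-1` B)).
  by rewrite /PP/= product_measure1E//; exact: preimage_measurable.
by apply/seteqP; split=> [[a b]|[a b]].
Qed.

Lemma copies_identically_distributed : identically_distributed copy1 copy2.
Proof.
by move=> A mA; rewrite /distribution/= /pushforward copy1_preimage// copy2_preimage.
Qed.

End iid_copies.

Lemma expectation_bernoulli_prod (R : realType) (p : R) (p01 : 0 <= p <= 1)
    (g : bool * bool -> R) : (forall x, 0 <= g x) ->
  'E_(bernoulli_prob p \x bernoulli_prob p)%E[g]%E =
  (p * (p * g (true, true) + (1 - p) * g (true, false)) +
   (1 - p) * (p * g (false, true) + (1 - p) * g (false, false)))%:E.
Proof.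
move=> g0; rewrite unlock fubini_tonelli1//=; last first.
  by move=> _ B _; exact: measurable_bool_prod.
rewrite /fubini_F integral_bernoulli_prob//; last first.
  by move=> x; apply: integral_ge0 => y _; rewrite lee_fin.
by rewrite !integral_bernoulli_prob// => x; rewrite lee_fin.
Qed.

(** An exponent at least 1 does not decrease the base [1 + y] and does not increase the base
    [1 - y]. *)
Lemma powR_add_sub_ge (R : realType) (alpha y : R) : 1 <= alpha -> 0 < y < 1 ->
  2 * y <= (1 + y) `^ alpha - (1 - y) `^ alpha.
Proof.
move=> a1 /andP[y0 y1].
have : 1 + y <= (1 + y) `^ alpha by apply: le1r_powR => //; lra.
have : (1 - y) `^ alpha <= 1 - y by apply: ge1r_powR => //; lra.
lra.
Qed.

(* [y = 4^(- alpha / (alpha - 2))] solves [y^(alpha - 2) = 4^(- alpha)]. *)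
Lemma small_powR_exists (R : realType) (alpha : R) : 2 < alpha ->
  exists2 y : R, 0 < y < 1 & y `^ alpha = y ^+ 2 / (2 `^ alpha) ^+ 2.
Proof.
move=> a2; pose y : R := 4 `^ (- (alpha / (alpha - 2))).
have y0 : 0 < y by rewrite powR_gt0.
have a20 : 0 < alpha - 2 by lra.
exists y.
  rewrite y0/= /y powRN invf_lt1 ?powR_gt0//.
  (* The exponent [alpha / (alpha - 2)] exceeds 1, so the power is at least 4. *)
  apply: (@lt_le_trans _ _ 4); first by lra.
  by apply: le1r_powR; [lra|rewrite ler_pdivlMr//; lra].
have -> : alpha = 2 + (alpha - 2) by ring.
rewrite powRD; last by rewrite (gt_eqF y0) implybT.
rewrite addrCA subrr addr0 powR_mulrn ?ltW//; congr (_ * _).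
rewrite -powRrM mulNr divfK ?gt_eqF// powRN; congr (_^-1).
by rewrite expr2 -powRM//; congr powR; lra.
Qed.

(** For the two-point law, this is the desired strict inequality with the term
    [2 p (1 - p) (1 - y)^alpha] of the moment of [X + Y] moved to the other side. *)
Lemma two_point_powR_lt (R : realType) (alpha : R) : 2 < alpha ->
  exists p y : R, [/\ 0 <= p <= 1, 0 < y < 1 &
    p ^+ 2 * 2 `^ alpha + (1 - p) ^+ 2 * (2 * y) `^ alpha <
    2 * p * (1 - p) * ((1 + y) `^ alpha - (1 - y) `^ alpha)].
Proof.
move=> a2; have [y y01 ya] := small_powR_exists a2.
have /andP[y0 y1] := y01.
set A := 2 `^ alpha in ya *.
have A0 : 0 < A by rewrite powR_gt0.
(* The odds [p / (1 - p)] are [2 y / A]. *)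
pose p := 2 * y / (A + 2 * y); exists p, y.
have D0 : 0 < A + 2 * y by lra.
have p0 : 0 < p by rewrite divr_gt0//; lra.
have p1 : p < 1 by rewrite ltr_pdivrMr//; lra.
split=> //; first by rewrite !ltW.
have := powR_add_sub_ge (_ : 1 <= alpha) y01.
set K := _ - _ => /(_ ltac:(lra)) K2.
apply: (@lt_le_trans _ _ (2 * p * (1 - p) * (2 * y))); last first.
  by apply: ler_wpM2l => //; rewrite mulr_ge0 ?subr_ge0 ?(ltW p1)// mulr_ge0 ?ltW.
rewrite powRM ?ltW// -/A ya -subr_gt0.
(* With [t = p / (1 - p)], the difference is [(1 - p)^2 (4 t y - A t^2 - y^2 / A)]. The chosen odds
   [t = 2 y / A] maximize the second factor, with value [3 y^2 / A]. *)
have -> : 2 * p * (1 - p) * (2 * y) -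
    (p ^+ 2 * A + (1 - p) ^+ 2 * (A * (y ^+ 2 / A ^+ 2))) =
    3 * A * y ^+ 2 / (A + 2 * y) ^+ 2.
  by rewrite /p; field; rewrite !gt_eqF.
by rewrite divr_gt0 ?exprn_gt0// !mulr_gt0// exprn_gt0.
Qed.

Theorem mainTheorem3 (R : realType) (alpha : R) (halpha : 2 < alpha) :
  exists (d : measure_display) (T : measurableType d) (P : probability T R)
         (X Y : {RV P >-> R}),
    [/\ independent_RV X Y,
        identically_distributed X Y,
        ('E_P[fun w => (`|X w| `^ alpha)%R] < +oo)%E &
        ('E_P[fun w => (`|X w + Y w| `^ alpha)%R]
           < 'E_P[fun w => (`|X w - Y w| `^ alpha)%R])%E].
Proof.
have [p [y [p01 /andP[y0 y1] ineq]]] := two_point_powR_lt halpha.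
pose f (b : bool) : R := if b then 1 else - y.
have mf : measurable_fun setT f by [].
exists _, _, (bernoulli_prob p \x bernoulli_prob p)%E, (copy1 _ mf), (copy2 _ mf).
split.
- exact: copies_independent.
- exact: copies_identically_distributed.
- by rewrite expectation_bernoulli_prod// ?ltry// => x; exact: powR_ge0.
rewrite !expectation_bernoulli_prod//; try by move=> x; exact: powR_ge0.
rewrite lte_fin /= /f /= !opprK subrr (addrC (- y) 1) addNr normr0.
(* The event [X = Y] contributes [0 ^ alpha], which vanishes since [alpha] is nonzero; by convention
   [0 ^ 0] is 1. *)
rewrite powR0; last by rewrite gt_eqF//; lra.
have -> : - y - 1 = - (1 + y) by ring.
have -> : - y - y = - (2 * y) by ring.
have -> : 1 + 1 = 2 :> R by ring.
rewrite !normrN !ger0_norm; try lra.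
Qed.
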